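(* Suppose $\Psi:[0,1]\to[0,1]$ is concave and non-decreasing. Then there exists a solution to the problem $\inf_{A\in\mathcal{A}}\mathrm{R}_\Psi(A)$, i.e. there is $A^*\in\mathcal{A}$ with $\mathrm{R}_\Psi(A^* )=\inf_{A\in\mathcal{A}}\mathrm{R}_\Psi(A)$.
   Context: Setting: $\mathcal{X}$ is a set, $\mathcal{A}\subset 2^{\mathcal{X}}$ a $\sigma$-algebra, and $\mu$ a probability measure on $(\mathcal{X}\times\{0,1\},\mathcal{A}\otimes 2^{\{0,1\}})$. For $i\in\{0,1\}$ put $\rho_i(B):=\mu(B\times\{i\})$, and $\rho:=\rho_0+\rho_1$. $\{\mathfrak{m}_x\}_{x\in\mathcal{X}}$ is a family such that $\mathfrak{m}_x$ is a probability measure on $(\mathcal{X},\mathcal{A})$ for $\rho$-almost every $x$, and $x\mapsto\mathfrak{m}_x(B)$ is measurable for every $B\in\mathcal{A}$. For $A\in\mathcal{A}$ (with $A^c=\mathcal{X}\setminus A$): $$\mathrm{R}_\Psi(A):=\int_{\mathcal{X}}\Psi(\mathfrak{m}_x(A))\,d\rho_0(x)+\int_{\mathcal{X}}\Psi(\mathfrak{m}_x(A^c))\,d\rho_1(x).$$ *)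

(* Defs.v *)
From HB Require Import structures.
From mathcomp Require Import all_boot all_order all_algebra.
From mathcomp Require Import all_classical all_reals all_analysis.

Set Implicit Arguments.
Unset Strict Implicit.
Unset Printing Implicit Defensive.
Import Order.TTheory GRing.Theory Num.Theory.

Local Open Scope classical_set_scope.
Local Open Scope ring_scope.
Local Open Scope ereal_scope.

(* [bool] with its discrete sigma-algebra stands for {0,1}: [false] is 0 and
   [true] is 1. *)
Definition label_measure d (X : measurableType d) (R : realType)
    (mu : probability (X * bool)%type R) (i : bool) (B : set X) : \bar R :=
  mu (B `*` [set i]).

Section label_measure.
Context d (X : measurableType d) (R : realType).
Variables (mu : probability (X * bool)%type R) (i : bool).

Local Notation rho_i := (label_measure mu i).

Let rho_i0 : rho_i set0 = 0.
Proof. by rewrite /label_measure set0X measure0. Qed.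

Let rho_i_ge0 B : 0 <= rho_i B.
Proof. exact: measure_ge0. Qed.

Let rho_i_sigma_additive : semi_sigma_additive rho_i.
Proof.
move=> F mF tF mUF; rewrite /label_measure setX_bigcupl.
apply: measure_semi_sigma_additive => [k|j k _ _ [[x b] [/= [Fjx _] [Fkx _]]]|].
- exact: measurableX.
- by apply: tF => //; exists x.
- by rewrite -setX_bigcupl; exact: measurableX.
Qed.

HB.instance Definition _ :=
  isMeasure.Build _ _ _ rho_i rho_i0 rho_i_ge0 rho_i_sigma_additive.

Let rho_i_fin : fin_num_fun rho_i.
Proof.
by move=> B mB; apply: fin_num_measure; exact: measurableX.
Qed.

HB.instance Definition _ := Measure_isFinite.Build _ _ _ rho_i rho_i_fin.

End label_measure.

Definition feature_marginal d (X : measurableType d) (R : realType)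
    (mu : probability (X * bool)%type R) : {measure set X -> \bar R} :=
  measure_add (label_measure mu false) (label_measure mu true).

(* Only the values on measurable sets are constrained. *)
Definition is_probability d (X : measurableType d) (R : realType)
    (p : set X -> \bar R) : Prop :=
  exists P : probability X R, forall B, measurable B -> p B = P B.

(* [Psi] matters only on [0, 1], where [m x A] lies for almost every [x]. On
   the exceptional null set the integrands are arbitrary, possibly not
   measurable; this does not change the integrals. *)
Definition Psi_risk d (X : measurableType d) (R : realType)
    (mu : probability (X * bool)%type R) (m : X -> set X -> \bar R)
    (Psi : R -> R) (A : set X) : \bar R :=
  \int[label_measure mu false]_x (Psi (fine (m x A)))%:E +
  \int[label_measure mu true]_x (Psi (fine (m x (~` A))))%:E.

(* Main.v *)
(* The risk is submodular in [A], because [Psi] is concave, and it is lower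
   semicontinuous along monotone sequences of sets, because a concave
   non-decreasing [Psi] is lower semicontinuous on [0, 1] (it can jump only at
   0). Let [A n] have risk within [2^-n] of the infimum. By submodularity the
   excesses add up along finite unions, so the risk of the union of the [A k],
   [k >= n], is within [2 * 2^-n] of the infimum, and the limsup of the [A n]
   is a minimizer. *)
Require Import Defs.
From mathcomp Require Import all_boot all_order all_algebra.
From mathcomp Require Import all_classical all_reals all_analysis.
From mathcomp Require Import measurable_realfun.
From mathcomp Require Import zify ring lra.
Import Order.TTheory GRing.Theory Num.Theory.
Import numFieldNormedType.Exports HBNNSimple.
Local Open Scope classical_set_scope.
Local Open Scope ring_scope.

(** * Concave functions on the unit interval *)

Section concave_unit_interval.
Context {R : realType} {Psi : R -> R}.
Hypothesis Psi_concave :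
  convex_function (E := R^o) `[0, 1]%classic (fun t : R^o => - Psi t).

Lemma concave_unit_le (l x y : R) :
  l \in `[0, 1] -> x \in `[0, 1] -> y \in `[0, 1] ->
  l * Psi x + (1 - l) * Psi y <= Psi (l * x + (1 - l) * y).
Proof.
rewrite in_itv /= => /andP[l0 l1] x01 y01.
have := Psi_concave (Itv01 l0 l1) x y; rewrite !inE => /(_ x01 y01).
by rewrite !convRE /= /unstable.onem !mulrN -opprD lerN2.
Qed.

(** With [l = (b - s) / (b - a)], the points [s] and [t] are the convex combinations of [a] and [b]
    with weights [l], [1 - l] and [1 - l], [l]; the two concavity bounds are added. *)
Lemma concave_unit_submod (a b s t : R) :
  a \in `[0, 1] -> b \in `[0, 1] -> a <= s <= b -> a + b = s + t ->
  Psi b + Psi a <= Psi s + Psi t.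
Proof.
move=> a01 b01 /andP[as_ sb] abst.
have -> : t = a + b - s by lra.
have [ab|ba] := ltP a b; last first.
  have -> : b = a by lra.
  have -> : s = a by lra.
  by rewrite addrK.
have ba0 : b - a != 0 by rewrite subr_eq0 gt_eqF.
pose l := (b - s) / (b - a).
have l01 : l \in `[0, 1].
  rewrite in_itv /= divr_ge0/= ?subr_ge0// ?(ltW ab)//.
  by rewrite ler_pdivrMr ?subr_gt0// mul1r lerB.
have := concave_unit_le _ _ _ l01 a01 b01.
have := concave_unit_le _ _ _ l01 b01 a01.
have -> : l * b + (1 - l) * a = a + b - s by rewrite /l; field.
have -> : l * a + (1 - l) * b = s by rewrite /l; field.
lra.
Qed.

Hypothesis Psi_ge0 : forall t, t \in `[0, 1] -> 0 <= Psi t.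
Hypothesis Psi_nondecr : {in `[0, 1] &, {homo Psi : s t / s <= t}}.

(* Concavity bounds [Psi] below by its chord from the origin, so that a
   downward jump of [Psi] is possible only as its argument reaches 0. *)
Lemma concave_unit_min_le (s t : R) : s \in `[0, 1] -> t \in `[0, 1] ->
  Num.min s t * Psi t <= t * Psi s.
Proof.
move=> s01 t01; have := s01; have := t01.
rewrite !in_itv /= => /andP[t0 t1] /andP[s0 s1].
have [st|ts] := leP s t; last first.
  by rewrite ler_wpM2l// Psi_nondecr// ltW.
have [t_eq0|t_neq0] := eqVneq t 0.
  have -> : s = 0 by lra.
  by rewrite t_eq0 !mul0r.
have tgt0 : 0 < t by lra.
have l01 : s / t \in `[0, 1].
  by rewrite in_itv /= divr_ge0// ler_pdivrMr// mul1r.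
have z01 : (0 : R) \in `[0, 1] by rewrite in_itv /= lexx ler01.
have := concave_unit_le _ _ _ l01 t01 z01; rewrite mulr0 addr0 divfK// => H.
have P0 : 0 <= (1 - s / t) * Psi 0.
  rewrite mulr_ge0 ?Psi_ge0// subr_ge0.
  by move: l01; rewrite in_itv /= => /andP[].
rewrite -ler_pdivrMl// mulrA [t^-1 * s]mulrC; lra.
Qed.

(** This is lower semicontinuity at [t], phrased as a limit so that dominated convergence can use
    it. At [t = 0] monotonicity makes the minimum constant; for [t > 0] it is squeezed between
    [Psi t] and a multiple of [Num.min (u n) t]. *)
Lemma cvg_min_concave_unit (u : R ^nat) (t : R) :
  (forall n, u n \in `[0, 1]) -> t \in `[0, 1] -> u n @[n --> \oo] --> t ->
  Num.min (Psi (u n)) (Psi t) @[n --> \oo] --> Psi t.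
Proof.
move=> u01 t01 ut; have := t01; rewrite in_itv /= => /andP[t0 t1].
have [t_eq0|t_neq0] := eqVneq t 0.
  have -> : (fun n => Num.min (Psi (u n)) (Psi t)) = cst (Psi t).
    apply/funext => n; apply/min_idPr; apply: Psi_nondecr => //.
    by rewrite t_eq0; have := u01 n; rewrite in_itv /= => /andP[].
  exact: cvg_cst.
have tgt0 : 0 < t by lra.
have mint : Num.min (u n) t @[n --> \oo] --> t.
  have -> : (fun n => Num.min (u n) t) =
      (fun n => 2^-1 * (u n + t - `|u n - t|)).
    apply/funext => n; rewrite /Num.min; case: ltP => h.
      by rewrite ltr0_norm ?subr_lt0//; field.
    by rewrite ger0_norm ?subr_ge0//; field.
  rewrite [X in _ --> X](_ : t = 2^-1 * (t + t - `|t - t|)); last first.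
    by rewrite subrr normr0; field.
  apply: cvgM; first exact: cvg_cst.
  apply: cvgB; first by apply: cvgD => //; exact: cvg_cst.
  by apply: cvg_norm; apply: cvgB => //; exact: cvg_cst.
apply: (squeeze_cvgr (f := fun n => t^-1 * Psi t * Num.min (u n) t)
          (h := cst (Psi t))).
- near=> n; rewrite ge_min lexx orbT andbT le_min.
  have Pt := Psi_ge0 _ t01.
  rewrite -mulrA ler_pdivrMl// [_ * Num.min _ _]mulrC concave_unit_min_le//=.
  by rewrite ler_pdivrMl// ler_wpM2r// ge_min lexx orbT.
- have {2}-> : Psi t = t^-1 * Psi t * t by field.
  by apply: cvgM => //; exact: cvg_cst.
- exact: cvg_cst.
Unshelve. all: by end_near. Qed.

End concave_unit_interval.

(** * Minimizing a submodular set function *)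

(** The last two hypotheses are lower semicontinuity along monotone sequences. The decreasing one
    asks for its bound only eventually, since the unions built in the proof are nearly optimal only
    for large [n]. *)
Lemma submodular_minimizer {d} {X : measurableType d} {R : realType}
    (F : set X -> R) :
  (forall A, measurable A -> 0 <= F A) ->
  (forall A B, measurable A -> measurable B ->
     F (A `|` B) + F (A `&` B) <= F A + F B) ->
  (forall (B : (set X)^nat) c, (forall n, measurable (B n)) ->
     nondecreasing_seq B -> (forall n, F (B n) <= c) ->
     F (\bigcup_n B n) <= c) ->
  (forall (B : (set X)^nat) c, (forall n, measurable (B n)) ->
     nonincreasing_seq B -> (\forall n \near \oo, F (B n) <= c) ->
     F (\bigcap_n B n) <= c) ->
  exists2 A, measurable A & forall B, measurable B -> F A <= F B.
Proof.
move=> F0 Fsub Fup Fdown.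
pose E := [set F A | A in [set A | measurable A]].
have Einf : has_inf E.
  split; first by exists (F set0), set0 => //; exact: measurable0.
  by exists 0 => _ [A mA <-]; exact: F0.
have infF A : measurable A -> inf E <= F A.
  by move=> mA; apply: ge_inf; [exact: (Einf.2)|exists A].
have /choice[A /all_and2[mA FA]] (n : nat) :
    exists A, measurable A /\ F A <= inf E + 2^-1 ^+ n.
  have e0 : (0 : R) < 2^-1 ^+ n by rewrite exprn_gt0// invr_gt0.
  have [_ [B mB <-] /ltW FB] := inf_adherent e0 Einf.
  by exists B.
(* [U n j] joins the [j + 1] sets from [A n] to [A (n + j)], so [U n 0] is [A n] rather than
   empty. *)
pose U n j := \big[setU/set0]_(n <= i < (n + j).+1) A i.
have mU n j : measurable (U n j) by apply: bigsetU_measurable => i _; exact: mA.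
have US n j : U n j.+1 = U n j `|` A (n + j).+1.
  by rewrite /U addnS big_nat_recr//= (leq_trans (leq_addr j n)).
(* The bound is [inf E] plus the sum of [2^-k] over [n <= k <= n + j]: as [F] is at least [inf E] on
   the intersection, each new set adds at most its own excess. *)
have FU n j : F (U n j) <= inf E + 2 * 2^-1 ^+ n - 2^-1 ^+ (n + j).
  elim: j => [|j IH].
    rewrite /U addn0 big_nat1; apply: (le_trans (FA n)); lra.
  have := Fsub _ _ (mU n j) (mA (n + j).+1).
  have := infF _ (measurableI _ _ (mU n j) (mA (n + j).+1)).
  have := FA (n + j).+1.
  rewrite US addnS exprS; lra.
pose B n := \bigcup_j U n j.
have mB n : measurable (B n) by apply: bigcupT_measurable => j; exact: mU.
have FB n : F (B n) <= inf E + 2 * 2^-1 ^+ n.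
  apply: Fup => //.
    apply/nondecreasing_seqP => j; apply/subsetPset.
    by rewrite US; exact: subsetUl.
  move=> j; apply: (le_trans (FU n j)).
  by rewrite lerBlDr lerDl exprn_ge0// invr_ge0.
have Bni : nonincreasing_seq B.
  apply/nonincreasing_seqP => n; apply/subsetPset => x [j _ Ujx].
  exists j.+1 => //; rewrite /U addnS -addSn big_ltn ?ltnS ?leq_addr//.
    by right.
  by lia.
exists (\bigcap_n B n); first exact: bigcapT_measurable.
move=> C mC; apply: le_trans (infF C mC); apply/ler_addgt0Pr => e e0.
apply: Fdown => //.
have : 2 * (2^-1 : R) ^+ n @[n --> \oo] --> (2 * 0 : R).
  apply: cvgM; [exact: cvg_cst|apply: cvg_expr].
  by rewrite ger0_norm ?invr_ge0// invf_lt1 ?ltr1n.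
rewrite mulr0 => /cvgrPdist_le/(_ _ e0); apply: filterS => n.
rewrite sub0r normrN => h.
by apply: (le_trans (FB n)); rewrite lerD2l; apply: le_trans (ler_norm _) h.
Qed.

(** * Discarding a null set from an integral *)

(** No measurability of [f] is assumed, because the integrands of [Psi_risk] are arbitrary on the
    exceptional set. For [f >= 0] the integral is a supremum over simple functions below [f], and
    cutting such a function to zero on [N] keeps its integral. *)
Lemma integral_setC_null {d} {T : measurableType d} {R : realType}
    (mu : {measure set T -> \bar R}) (N : set T) (f : T -> \bar R) :
  measurable N -> mu N = 0%E ->
  (\int[mu]_x f x = \int[mu]_(x in ~` N) f x)%E.
Proof.
move=> mN N0.
wlog f0 : f / forall x, (0 <= f x)%E.
  by move=> H; rewrite integralE [RHS]integralE !H.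
have g0 x : (0 <= (f \_ (~` N)) x)%E by apply: erestrict_ge0.
rewrite [RHS]integral_mkcond !ge0_integralTE//.
apply/eqP; rewrite eq_le; apply/andP; split; last first.
  apply: ereal_sup_le => _ [h /= hg <-].
  exists h => // x; apply: (le_trans (hg x)).
  by rewrite patchE; case: ifP.
apply: ge_ereal_sup => _ [h /= hf <-]; apply: ereal_sup_ubound.
have mN' := measurableC mN.
exists (proj_nnsfun h mN') => [x|].
  by rewrite -mrestrict !patchE; case: ifP.
rewrite -mrestrict -integral_nnsfun// -integralT_nnsfun.
rewrite (@ge0_negligible_integral _ _ _ mu setT N)//= ?setTD//.
- by apply/measurable_EFinP.
- by move=> x _; rewrite lee_fin.
Qed.

(** * Set functions that agree with a probability on measurable sets *)

Section probability_kernel.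
Context {d} {X : measurableType d} {R : realType}.
Implicit Types (p : set X -> \bar R) (A B : set X).

Lemma is_probability_fine p A : is_probability p -> measurable A ->
  (fine (p A))%:E = p A.
Proof. by move=> [P pP] mA; rewrite fineK// pP// fin_num_measure. Qed.

Lemma is_probability_itv p A : is_probability p -> measurable A ->
  fine (p A) \in `[0, 1].
Proof.
move=> p_prob mA; rewrite in_itv/= -!lee_fin is_probability_fine//.
by have [P pP] := p_prob; rewrite pP// measure_ge0 probability_le1.
Qed.

Lemma is_probability_le p A B : is_probability p -> measurable A ->
  measurable B -> A `<=` B -> fine (p A) <= fine (p B).
Proof.
move=> p_prob mA mB AB; rewrite -lee_fin !is_probability_fine//.
by have [P pP] := p_prob; rewrite !pP// le_measure ?inE.
Qed.

Lemma is_probabilityUI p A B : is_probability p -> measurable A ->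
  measurable B ->
  fine (p (A `&` B)) + fine (p (A `|` B)) = fine (p A) + fine (p B).
Proof.
move=> p_prob mA mB; apply: EFin_inj.
have mI := measurableI _ _ mA mB; have mU := measurableU _ _ mA mB.
rewrite !EFinD !is_probability_fine//; have [P pP] := p_prob; rewrite !pP//.
have ltP : (P A < +oo)%E by rewrite ltey_eq fin_num_measure.
by rewrite measureUfinl// addeC subeK// fin_num_measure.
Qed.

(** Assuming the limit under every [P] covers increasing unions, decreasing intersections and their
    complements at once. *)
Lemma is_probability_cvg p (B : (set X)^nat) (C : set X) :
  is_probability p -> (forall n, measurable (B n)) -> measurable C ->
  (forall P : probability X R, P (B n) @[n --> \oo] --> P C) ->
  fine (p (B n)) @[n --> \oo] --> fine (p C).
Proof.
move=> [P pP] mB mC cvgP; rewrite (pP C)//.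
under eq_fun do rewrite pP//.
by apply: fine_cvg; rewrite fineK ?fin_num_measure//; exact: cvgP.
Qed.

End probability_kernel.

(** * The contribution of one label to the risk *)

(** [G] will be a set of full measure on which every [m x] is a probability; there the integral is
    finite for measurable [A], so [fine] loses nothing. *)
Definition restricted_risk {d} {X : measurableType d} {R : realType}
    (rho : set X -> \bar R) (G : set X) (m : X -> set X -> \bar R)
    (Psi : R -> R) (A : set X) : R :=
  fine (\int[rho]_(x in G) (Psi (fine (m x A)))%:E)%E.

Section restricted_risk.
Context {d} {X : measurableType d} {R : realType}.
Context {rho : {finite_measure set X -> \bar R}} {G : set X}.
Context {m : X -> set X -> \bar R} {Psi : R -> R}.
Hypothesis mG : measurable G.
Hypothesis m_prob : forall x, G x -> is_probability (m x).
Hypothesis m_meas : forall B, measurable B -> measurable_fun [set: X] (m ^~ B).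
Hypothesis Psi01 : forall t : R, t \in `[0, 1] -> Psi t \in `[0, 1].
Hypothesis Psi_concave :
  convex_function (E := R^o) `[0, 1]%classic (fun t : R^o => - Psi t).
Hypothesis Psi_nondecr : {in `[0, 1] &, {homo Psi : s t / s <= t}}.

Local Notation restricted_risk := (restricted_risk rho G m Psi).

Let f (A : set X) (x : X) : \bar R := (Psi (fine (m x A)))%:E.

Lemma Psi_itv x A : G x -> measurable A -> 0 <= Psi (fine (m x A)) <= 1.
Proof.
move=> Gx mA; have := Psi01 _ (is_probability_itv _ _ (m_prob _ Gx) mA).
by rewrite in_itv.
Qed.

Lemma measurable_Psi A : measurable A -> measurable_fun G (f A).
Proof.
move=> mA; apply/measurable_EFinP.
(* [Psi] is monotone only on [0, 1]; composing with [clamp] gives a function monotone on the whole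
   line, hence measurable, with the same values on [G]. *)
pose clamp (t : R) := Num.min 1 (Num.max 0 t).
have clamp01 t : clamp t \in `[0, 1].
  by rewrite in_itv /= le_min ler01 le_max lexx ge_min lexx.
apply: (eq_measurable_fun (fun x => Psi (clamp (fine (m x A))))).
  move=> x; rewrite inE => /m_prob/(is_probability_itv _ _)/(_ mA).
  by rewrite in_itv/= => /andP[h0 h1]; rewrite /clamp max_r// min_r.
apply: (measurableT_comp (f := Psi \o clamp)).
  apply: nondecreasing_measurable => // s t st.
  by apply: Psi_nondecr => //; rewrite le_min2// le_max2.
apply: (measurableT_comp (f := fine)); first exact: fine_measurable.
by apply: measurable_funTS; exact: m_meas.
Qed.

Lemma integrable_Psi A : measurable A -> rho.-integrable G (f A).
Proof.
move=> mA; apply: (@le_integrable _ _ _ _ _ mG _ (cst 1%:E)).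
- exact: measurable_Psi.
- move=> x Gx; have /andP[P0 P1] := Psi_itv _ _ Gx mA.
  by rewrite /f /= normr1 lee_fin ger0_norm.
- exact: finite_measure_integrable_cst.
Qed.

Lemma restricted_riskE A : measurable A ->
  (restricted_risk A)%:E = (\int[rho]_(x in G) f A x)%E.
Proof. by move=> mA; rewrite fineK// integrable_fin_num// integrable_Psi. Qed.

Lemma restricted_risk_ge0 A : measurable A -> 0 <= restricted_risk A.
Proof.
move=> mA; rewrite -lee_fin restricted_riskE//; apply: integral_ge0 => x Gx.
by rewrite lee_fin; case/andP: (Psi_itv _ _ Gx mA).
Qed.

(** The inequality holds pointwise: [m x A] lies between the masses of the intersection and the
    union, and modularity of a probability gives the equality of sums that concavity needs. *)
Lemma restricted_risk_submod A B : measurable A -> measurable B ->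
  restricted_risk (A `|` B) + restricted_risk (A `&` B) <=
  restricted_risk A + restricted_risk B.
Proof.
move=> mA mB.
have mI := measurableI _ _ mA mB; have mU := measurableU _ _ mA mB.
rewrite -lee_fin !EFinD !restricted_riskE//.
have i := integrable_Psi; rewrite -!integralD//; try exact: i.
apply: le_integral => //; try by apply: integrableD => //; exact: i.
move=> x; rewrite inE => Gx; rewrite -!EFinD lee_fin.
have pmx := m_prob _ Gx.
apply: concave_unit_submod => //; try exact: is_probability_itv.
- by apply/andP; split; apply: is_probability_le.
- exact: is_probabilityUI.
Qed.

(* Dominated convergence applies to the minimum of the integrand along [B] and
   its limit, which converges although the integrand itself may not. *)
Lemma restricted_risk_cvg (B : (set X)^nat) (C : set X) :
  (forall n, measurable (B n)) -> measurable C ->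
  (forall P : probability X R, P (B n) @[n --> \oo] --> P C) ->
  exists2 u : R^nat, (forall n, u n <= restricted_risk (B n)) &
    u n @[n --> \oo] --> restricted_risk C.
Proof.
move=> mB mC BC.
pose g n x := mine (f (B n) x) (f C x).
have mg n : measurable_fun G (g n).
  by apply: measurable_mine; exact: measurable_Psi.
have g1 n x : G x -> (`|g n x| <= 1)%E.
  move=> Gx; rewrite /g /f -EFin_min abse_EFin lee_fin.
  have /andP[? ?] := Psi_itv _ _ Gx (mB n).
  have /andP[? ?] := Psi_itv _ _ Gx mC.
  by rewrite ger0_norm ?le_min ?ge_min; [apply/orP; left|apply/andP].
have ic := finite_measure_integrable_cst rho 1 mG.
have ig n : rho.-integrable G (g n).
  by apply: (le_integrable mG _ _ ic) => // x Gx; rewrite /= normr1 g1.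
have cg : (\int[rho]_(x in G) g n x)%E @[n --> \oo] -->
    (\int[rho]_(x in G) f C x)%E.
  apply: (dominated_cvg mG _ _ _ ic) => //.
  move=> x Gx; rewrite /g /f; under eq_fun do rewrite -EFin_min.
  apply: cvg_EFin; first exact: nearW.
  have pmx := m_prob _ Gx.
  apply: (@cvg_min_concave_unit _ _ Psi_concave) => //.
  - by move=> t /Psi01; rewrite in_itv => /andP[].
  - by move=> n; exact: is_probability_itv.
  - exact: is_probability_itv.
  - exact: is_probability_cvg.
exists (fun n => fine (\int[rho]_(x in G) g n x)%E) => [n|].
  rewrite -lee_fin restricted_riskE// fineK ?integrable_fin_num//.
  apply: le_integral => //; first exact: integrable_Psi.
  by move=> x _; rewrite /g ge_min lexx.
by apply: fine_cvg; rewrite restricted_riskE.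
Qed.

End restricted_risk.

(** * Existence of an optimal set *)

Theorem theorem2 (R : realType) (d : measure_display) (X : measurableType d)
    (mu : probability (X * bool)%type R)
    (m : X -> set X -> \bar R)
    (m_prob : {ae feature_marginal mu, forall x, is_probability (m x)})
    (m_meas : forall B : set X, measurable B ->
       measurable_fun [set: X] (m ^~ B))
    (Psi : R -> R)
    (Psi01 : forall t : R, t \in `[0, 1] -> Psi t \in `[0, 1])
    (Psi_concave :
       convex_function (E := R^o) `[0, 1]%classic (fun t : R^o => - Psi t))
    (Psi_nondecr : {in `[0, 1] &, {homo Psi : s t / s <= t}}) :
  exists2 Astar : set X, measurable Astar &
    Psi_risk mu m Psi Astar =
      ereal_inf [set Psi_risk mu m Psi A | A in [set A | measurable A]].
Proof.
have [N [mN N0 subN]] := m_prob.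
have muN i : label_measure mu i N = 0%E.
  have : (label_measure mu false N + label_measure mu true N = 0)%E.
    by rewrite -[RHS]N0 -measure_addE.
  move/eqP; rewrite padde_eq0 ?measure_ge0// => /andP[/eqP ? /eqP ?].
  by case: i.
have mG := measurableC mN.
have m_probG x : (~` N) x -> is_probability (m x).
  by move=> Nx; apply: contrapT => /subN.
pose J i A := restricted_risk (label_measure mu i) (~` N) m Psi A.
pose F A := J false A + J true (~` A).
have J_ge0 i A : measurable A -> 0 <= J i A by exact: restricted_risk_ge0.
have J_submod i A B : measurable A -> measurable B ->
    J i (A `|` B) + J i (A `&` B) <= J i A + J i B.
  by exact: restricted_risk_submod.
have riskE A : measurable A -> Psi_risk mu m Psi A = (F A)%:E.
  move=> mA; rewrite /Psi_risk EFinD !restricted_riskE//; last first.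
    exact: measurableC.
  by rewrite !(integral_setC_null _ N)//; exact: muN.
have F_lsc (B : (set X)^nat) C c :
    (forall n, measurable (B n)) -> measurable C ->
    (forall P : probability X R, P (B n) @[n --> \oo] --> P C) ->
    (\forall n \near \oo, F (B n) <= c) -> F C <= c.
  move=> mB mC BC Bc.
  have J_cvg i := restricted_risk_cvg (rho := label_measure mu i)
    mG m_probG m_meas Psi01 Psi_concave Psi_nondecr.
  have [u uB uC] := J_cvg false _ _ mB mC BC.
  have mB' n : measurable (~` B n) by exact: measurableC.
  have mC' : measurable (~` C) by exact: measurableC.
  have BC' (P : probability X R) : P (~` B n) @[n --> \oo] --> P (~` C).
    rewrite probability_setC//; under eq_fun do rewrite probability_setC//.
    apply: cvgeB; [|exact: cvg_cst|exact: BC].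
    by rewrite fin_num_adde_defr.
  have [v vB vC] := J_cvg true _ _ mB' mC' BC'.
  (* [u n + v n] is at most [F (B n)], hence eventually at most [c], and it converges to [F C]. *)
  apply: (cvgr_to_le (cvgD uC vC)); apply: filterS Bc => n.
  by apply: le_trans; rewrite lerD.
have [A mA Amin] :
    exists2 A, measurable A & forall B, measurable B -> F A <= F B.
  apply: submodular_minimizer.
  - by move=> A mA; rewrite addr_ge0 ?J_ge0//; exact: measurableC.
  (* Complementation exchanges union and intersection, so the second term is submodular in [A]
     too. *)
  - move=> A B mA mB; rewrite /F setCU setCI.
    have := J_submod false _ _ mA mB.
    have := J_submod true _ _ (measurableC mA) (measurableC mB); lra.
  - move=> B c mB ndB Bc; apply: (F_lsc B) => //.
    + exact: bigcupT_measurable.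
    + move=> P; apply: nondecreasing_cvg_mu => //; exact: bigcupT_measurable.
    + exact: nearW.
  - move=> B c mB niB Bc; apply: (F_lsc B) => //.
    + exact: bigcapT_measurable.
    + move=> P; apply: nonincreasing_cvg_mu => //.
        by rewrite ltey_eq fin_num_measure.
      exact: bigcapT_measurable.
exists A => //; apply/eqP; rewrite eq_le; apply/andP; split.
  by apply: le_ereal_inf_tmp => _ [B mB <-]; rewrite !riskE// lee_fin Amin.
by apply: ereal_inf_lbound; exists A.
Qed.
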